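(* Let $(\alpha,\beta)$ satisfy one of the following conditions: (I) $0<\alpha<2$, $\alpha\neq 1$, $-1<\beta<1$; (II) $1<\alpha<2$, $\beta=\pm 1$; (III) $\alpha=1$, $\beta=0$. Let $X$ be the stable process with parameters $(\alpha,\beta)$, and let $a(t)>0$ be a function of $t>0$ such that $$\frac{t}{[a(t)]^{\alpha}}\to 0,\qquad t\to\infty.$$ Then the following equalities are true: 1) $\displaystyle \lim_{t\to\infty}p_\alpha(t,a(t))=1$. 2) $\displaystyle \lim_{t\to\infty}P\Big[\sup_{0\le\tau\le t}|X(\tau)|>a(t)\Big]=0$.
   Context: The stable process $X(\tau)$, $\tau\ge 0$, with parameters $(\alpha,\beta)$ is the homogeneous process with independent increments (Lévy process), $X(0)=0$, with $$E[\exp(i\xi X(\tau))]=\exp\{-\tau|\xi|^{\alpha}[1-i\beta(\mathrm{sign}\,\xi)\tan(\pi\alpha/2)]\}\quad(\alpha\neq 1),$$ $$E[\exp(i\xi X(\tau))]=\exp\{-\tau|\xi|[1+\tfrac{2i\beta}{\pi}(\mathrm{sign}\,\xi)\log|\xi|]\}\quad(\alpha=1).$$ For $t,a>0$, $p_\alpha(t,a)=P(\sup_{0\le\tau\le t}|X(\tau)|<a)$. *)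

(* Defs.v *)
From HB Require Import structures.
From mathcomp Require Import all_boot all_order all_algebra.
From mathcomp Require Import complex.
From mathcomp Require Import all_classical all_reals all_analysis.

Set Implicit Arguments.
Unset Strict Implicit.
Unset Printing Implicit Defensive.

Import Order.TTheory GRing.Theory Num.Theory.
Import numFieldNormedType.Exports.

Local Open Scope classical_set_scope.
Local Open Scope ring_scope.

Definition cexp (R : realType) (z : R[i]) : R[i] :=
  let: (x +i* y)%C := z in (expR x * cos y +i* (expR x * sin y))%C.

(* Each component is the expectation of a bounded random variable, so it is
   finite and [fine] loses nothing. *)
Definition char_fun (d : measure_display) (T : measurableType d)
    (R : realType) (P : probability T R) (Y : {RV P >-> R}) (xi : R) : R[i] :=
  (fine 'E_P[fun w => cos (xi * Y w)] +i* fine 'E_P[fun w => sin (xi * Y w)])%C.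

(* The events [B i] range over all measurable sets, [setT] included, so the
   product rule for subfamilies is covered. *)
Definition mutually_independent (d : measure_display) (T : measurableType d)
    (R : realType) (P : probability T R) (n : nat)
    (Y : 'I_n -> T -> R) : Prop :=
  forall B : 'I_n -> set R, (forall i, measurable (B i)) ->
    P (\bigcap_(i in [set: 'I_n]) (Y i @^-1` B i)) =
    (\prod_(i < n) P (Y i @^-1` B i))%E.

(* Processes are indexed by the whole of [R]; only times [0 <= tau] matter. *)
Definition increment (d : measure_display) (T : measurableType d)
    (R : realType) (P : probability T R) (X : R -> {RV P >-> R}) (s t : R) :
    T -> R := fun w => X t w - X s w.

Definition independent_increments (d : measure_display)
    (T : measurableType d) (R : realType) (P : probability T R)
    (X : R -> {RV P >-> R}) : Prop :=
  forall (n : nat) (s : nat -> R), 0 <= s 0%N ->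
    (forall i, (i < n)%N -> s i < s i.+1) ->
    mutually_independent P (fun i : 'I_n => increment X (s i) (s i.+1)).

Definition homogeneous (d : measure_display) (T : measurableType d)
    (R : realType) (P : probability T R) (X : R -> {RV P >-> R}) : Prop :=
  forall s s' h : R, 0 <= s -> 0 <= s' -> 0 <= h ->
    forall B : set R, measurable B ->
      P (increment X s (s + h) @^-1` B) = P (increment X s' (s' + h) @^-1` B).

Definition cadlag (R : realType) (f : R -> R) : Prop :=
  (forall t : R, 0 <= t -> f s @[s --> t^'+] --> f t) /\
  (forall t : R, 0 < t -> cvg (f s @[s --> t^'-])).

(* Regular sample paths are part of the notion of a Lévy process; they are what
   makes suprema over uncountable time intervals random variables. *)
Definition levy_process (d : measure_display) (T : measurableType d)
    (R : realType) (P : probability T R) (X : R -> {RV P >-> R}) : Prop :=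
  [/\ forall w, X 0 w = 0,
      independent_increments X,
      homogeneous X &
      forall w, cadlag (fun t => X t w)].

(* At [xi = 0] and [alpha = 1], [ln 0] is [0] and is multiplied by [`|xi| = 0],
   so the exponent is [0], as it should be. *)
Definition stable_exponent (R : realType) (alpha beta xi : R) : R[i] :=
  if alpha == 1 then
    (`|xi|%:C * (1 + (2 * beta / pi)%:C * 'i * (Num.sg xi * ln `|xi|)%:C))%C
  else
    ((`|xi| `^ alpha)%:C *
      (1 - 'i * (beta * Num.sg xi * tan (pi * alpha / 2))%:C))%C.

Definition stable_process (d : measure_display) (T : measurableType d)
    (R : realType) (P : probability T R) (X : R -> {RV P >-> R})
    (alpha beta : R) : Prop :=
  levy_process X /\
  forall tau xi : R, 0 <= tau ->
    char_fun (X tau) xi = cexp (- (tau%:C%C * stable_exponent alpha beta xi)).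

Definition sup_abs (d : measure_display) (T : measurableType d)
    (R : realType) (P : probability T R) (X : R -> {RV P >-> R})
    (t : R) (w : T) : \bar R :=
  ereal_sup [set `|X tau w|%:E | tau in [set tau | 0 <= tau <= t]].

Definition p_alpha (d : measure_display) (T : measurableType d)
    (R : realType) (P : probability T R) (X : R -> {RV P >-> R})
    (t a : R) : \bar R :=
  P [set w | (sup_abs X t w < a%:E)%E].

(* Main.v *)
(* Put r = t / a^alpha. Since |1 - E exp(i xi X(tau))| = O(tau |xi|^alpha), the
   tail P(|X(tau)| > a) is O(r) uniformly in tau <= t; the characteristic
   function is only sampled at the dyadic frequencies 2^-k / a, which replaces
   the usual averaging over xi. An Ottaviani-type inequality for the independent
   increments along dyadic grids, together with right continuity of the paths,
   transfers the bound to the supremum over [0, t]: its tail is O(r) as well. *)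
From mathcomp Require Import complex.
Require Import Defs.
From mathcomp Require Import all_boot all_order all_algebra.
From mathcomp Require Import all_classical all_reals all_analysis.
From mathcomp Require Import measurable_realfun ring lra.

Set Implicit Arguments.
Unset Strict Implicit.
Unset Printing Implicit Defensive.

Import Order.TTheory GRing.Theory Num.Theory.
Import numFieldNormedType.Exports.

Local Open Scope classical_set_scope.
Local Open Scope ring_scope.

(** * Elementary inequality for characteristic functions; measurability of level sets *)

Lemma one_sub_expcos_le (R : realType) (x y : R) : 0 <= x ->
  1 - expR (- x) * cos y <= x + `|y|.
Proof.
move=> x0.
have e1 : 1 - x <= expR (- x) by exact: expR_ge1Dx.
have e2 : expR (- x) <= 1 by rewrite -expR0 ler_expR; lra.
have e0 : 0 < expR (- x) by exact: expR_gt0.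
(* For [y >= 0] the function [z + cos z] has derivative [1 - sin z >= 0], so the mean value theorem
   bounds it below by its value [1] at the origin; evenness of [cos] handles negative [y]. *)
have hc : 1 - cos y <= `|y|.
  wlog y0 : y / 0 <= y.
    move=> H; have [|/ltW y0] := lerP 0 y; first exact: H.
    by rewrite -normrN -cosN; apply: H; rewrite oppr_ge0.
  rewrite (ger0_norm y0).
  have df (z : R) : z \in `]0, y[ ->
      is_derive z 1 ((fun z : R => z) + cos) (1 - sin z).
    by move=> _; apply: is_derive_eq.
  have cf : {within `[0, y], continuous ((fun z : R => z) + cos)}.
    apply: continuous_subspaceT => z; apply: cvgD; first exact: cvg_id.
    exact: continuous_cos.
  have [z _] := MVT_segment y0 df cf.
  rewrite /= !fctE cos0 subr0 => E.
  have := sin_le1 z; have : 0 <= (1 - sin z) * y; last lra.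
  by rewrite mulr_ge0// subr_ge0 sin_le1.
(* Split [1 - expR (- x) * cos y] as [(1 - expR (- x)) + expR (- x) * (1 - cos y)]: the first term
   is at most [x], the second at most [|y|]. *)
have c1 := cos_le1 y.
have := normr_ge0 y.
nra.
Qed.

Lemma measurable_norm_itv d (T : measurableType d) (R : realType) (f : T -> R)
    (i : interval R) :
  measurable_fun setT f -> measurable [set w | `|f w| \in i].
Proof.
move=> mf; rewrite -[X in measurable X]setTI.
exact: (measurableT_comp (@normr_measurable R setT) mf) (measurable_itv i).
Qed.

Lemma measurable_norm_gt d (T : measurableType d) (R : realType) (f : T -> R)
    (c : R) :
  measurable_fun setT f -> measurable [set w | c < `|f w|].
Proof.
move=> /(@measurable_norm_itv _ _ _ _ `]c, +oo[); congr measurable.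
by apply/seteqP; split=> w /=; rewrite in_itv/= andbT.
Qed.

Lemma measurable_norm_seg d (T : measurableType d) (R : realType) (f : T -> R)
    (a b : R) :
  measurable_fun setT f -> measurable [set w | a <= `|f w| <= b].
Proof.
exact: (@measurable_norm_itv _ _ _ _ `[a, b]).
Qed.

(** * Tail estimates from the characteristic function *)

Lemma sub1_cos1_gt0 (R : realType) : 0 < 1 - cos 1 :> R.
Proof.
by rewrite subr_gt0 -[ltRHS]cos0 ltr_cos// !in_itv/= ?lexx ?pi_ge0// ler01
  (le_trans _ (pi_ge2 R)) ?ler1n.
Qed.

(** Since [2 <= pi] and [cos] decreases on [[0, pi]], the nonnegative variable [1 - cos (xi * Y)] is
    at least [1 - cos 1] on the event; Markov's inequality applies to it. *)
Lemma markov_cos d (T : measurableType d) (R : realType) (P : probability T R)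
    (Y : {RV P >-> R}) (xi : R) :
  (P [set w | (1 <= `|xi * Y w| <= 2)%R] <=
   ((1 - fine 'E_P[fun w => cos (xi * Y w)]) / (1 - cos 1))%:E)%E.
Proof.
have c1 := sub1_cos1_gt0 R.
have mxY : measurable_fun setT (fun w => xi * Y w : R).
  by apply: measurable_funM.
have mcos : measurable_fun setT (fun w => cos (xi * Y w)).
  by apply: measurableT_comp => //; apply: continuous_measurable_fun;
     exact: continuous_cos.
have icos : P.-integrable setT (EFin \o (fun w => cos (xi * Y w))).
  apply: measurable_bounded_integrable => //; first exact: fin_num_fun_lty.
  exists 1; split => // M M1 w _ /=.
  by rewrite (le_trans (cos_max _))// ltW.
have i1 : P.-integrable setT (EFin \o (cst 1 : T -> R)).
  apply: measurable_bounded_integrable => //; first exact: fin_num_fun_lty.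
  by exists 1; split => // M M1 w _ /=; rewrite normr1 ltW.
have mA := measurable_norm_seg 1 2 mxY.
have E1 : (\int[P]_w (1 - cos (xi * Y w))%:E =
   (1 - fine 'E_P[fun w => cos (xi * Y w)])%:E)%E.
  under eq_integral do rewrite EFinB.
  rewrite (integralB_EFin _ i1 icos)//.
  have -> : (\int[P]_x (cst 1 x : R)%:E = 1)%E.
    have := integral_cst P measurableT 1%:E.
    by rewrite /= probability_setT mule1.
  rewrite EFinB expectation.unlock fineK//.
  exact: (integrable_fin_num measurableT icos).
have m1c : measurable_fun setT (fun w => (1 - cos (xi * Y w))%:E).
  by apply/measurable_EFinP; exact: measurable_funB.
have le1 : ((1 - cos 1)%:E * P [set w | (1 <= `|xi * Y w| <= 2)%R] <=
    (1 - fine 'E_P[fun w => cos (xi * Y w)])%:E)%E.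
  rewrite -E1.
  apply: (@le_trans _ _ ((1 - cos 1)%:E *
      P ([set: T] `&`
         [set w | ((1 - cos 1)%:E <= `|(1 - cos (xi * Y w))%:E|)%E]))%E).
    rewrite lee_pmul2l// le_measure// ?inE//.
      by apply: emeasurable_fun_c_infty => //; apply: measurableT_comp.
    move=> w /= /andP[w1 w2]; split => //.
    rewrite lee_fin (le_trans _ (ler_norm _))// lerB//.
    rewrite -(cos_norm (xi * _)) leNgt ltr_cos -?leNgt//.
    - by rewrite in_itv/= normr_ge0 (le_trans w2 (pi_ge2 R)).
    - by rewrite in_itv/= ler01 (le_trans _ (pi_ge2 R))// ler1n.
  apply: le_trans (@le_integral_comp_abse _ _ _ P setT measurableT
    (fun w => (1 - cos (xi * Y w))%:E) (1 - cos 1) id _ _ _ _ _) _ => //.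
  apply: ge0_le_integral => //.
    exact: measurableT_comp.
  by move=> w _; rewrite gee0_abs// lee_fin subr_ge0 cos_le1.
by rewrite EFinM lee_pdivlMr// muleC.
Qed.

Lemma lt_pow2 (R : realType) (x : R) : exists n : nat, x < 2 ^+ n.
Proof.
exists (Num.truncn x).+1; apply: lt_trans (truncnS_gt x) _.
by rewrite -natrX ltr_nat ltn_expl.
Qed.

Lemma half_powR_lt1 (R : realType) (alpha : R) :
  0 < alpha -> 2^-1 `^ alpha < 1 :> R.
Proof.
move=> alpha0; have := @gt0_ltr_powR R alpha alpha0 2^-1 1.
by rewrite powR1; apply; rewrite ?nnegrE ?invr_ge0// invf_lt1// ltr1n.
Qed.

(* Whenever [c < |Y|], some frequency [xi = c^-1 2^-k] puts [|xi Y|] in [1, 2],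
   where [1 - cos] is at least [1 - cos 1]; Markov's inequality at each of these
   frequencies leaves a geometric series of ratio [2^-alpha]. *)
Lemma tail_le d (T : measurableType d) (R : realType) (P : probability T R)
    (Y : {RV P >-> R}) (alpha D c : R) : 0 < alpha -> 0 <= D -> 0 < c ->
  (forall xi, 1 - fine 'E_P[fun w => cos (xi * Y w)] <= D * `|xi| `^ alpha) ->
  (P [set w | (c < `|Y w|)%R] <=
   (D / (1 - cos 1) / (1 - 2^-1 `^ alpha) * c^-1 `^ alpha)%:E)%E.
Proof.
move=> alpha0 D0 c0 HD.
have c1 := sub1_cos1_gt0 R.
have mY : measurable_fun setT Y by [].
have mc := measurable_norm_gt c mY.
pose xi k : R := c^-1 * 2^-1 ^+ k.
have xi0 k : 0 < xi k by rewrite mulr_gt0 ?invr_gt0// exprn_gt0// invr_gt0.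
have mA k : measurable [set w | 1 <= `|xi k * Y w| <= 2].
  by apply: measurable_norm_seg; exact: measurable_funM.
have cover : [set w | c < `|Y w|] `<=`
    \bigcup_k [set w | 1 <= `|xi k * Y w| <= 2].
  move=> w /= cY.
  have [k] : exists k : nat, `|xi k * Y w| <= 2.
    have [k hk] := lt_pow2 (c^-1 * `|Y w|).
    exists k; rewrite normrM gtr0_norm// /xi mulrAC exprVn.
    rewrite ler_pdivrMr ?exprn_gt0// (le_trans (ltW hk))//.
    by rewrite ler_peMl ?exprn_ge0// ler1n.
  have xiY : forall k, `|xi k * Y w| = xi k * `|Y w|.
    by move=> j; rewrite normrM gtr0_norm.
  (* Halving the frequency cannot jump over [[1, 2]]: if [xi k * |Y w|] exceeds 2, then at [k.+1]
     the product still exceeds 1. At [k = 0] the lower bound is [c < |Y w|] itself. *)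
  rewrite xiY; elim: k => [|k IH] hk.
    exists 0%N => //=; rewrite xiY hk andbT /xi expr0 mulr1.
    by rewrite mulrC ler_pdivlMr// mul1r ltW.
  have [h|h] := lerP (xi k * `|Y w|) 2; first exact: IH.
  exists k.+1 => //=; rewrite xiY hk andbT.
  move: h; rewrite /xi exprS; lra.
set q := 2^-1 `^ alpha.
have q01 : 0 < q < 1.
  by rewrite powR_gt0 ?invr_gt0//= half_powR_lt1.
apply: (le_trans (measure_sigma_subadditive P mA mc cover)).
have bk k : (P [set w | (1 <= `|xi k * Y w| <= 2)%R] <=
    (geometric (D / (1 - cos 1) * c^-1 `^ alpha) q k)%:E)%E.
  rewrite (le_trans (markov_cos _ _))// lee_fin /=.
  have -> : q ^+ k = (2^-1 ^+ k) `^ alpha.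
    by rewrite -!powR_mulrn ?powR_ge0 ?invr_ge0// powRAC.
  have /= := HD (xi k); rewrite gtr0_norm// /xi.
  rewrite powRM ?invr_ge0 ?exprn_ge0 ?invr_ge0// ?(ltW c0)//.
  rewrite ler_pdivrMr// => /le_trans; apply; rewrite le_eqVlt; apply/orP; left.
  by apply/eqP; field; rewrite gt_eqF.
apply: lime_le; first by apply: is_cvg_nneseries => *; exact: measure_ge0.
near=> n.
apply: (@le_trans _ _ (\sum_(0 <= k < n)
    (geometric (D / (1 - cos 1) * c^-1 `^ alpha) q k)%:E)%E).
  by apply: lee_sum => k _; exact: bk.
rewrite sumEFin lee_fin.
have /andP[q0 q1] := q01.
rewrite [leRHS]mulrAC; apply: (geometric_le_lim n) => //.
  by rewrite mulr_ge0 ?powR_ge0// divr_ge0// ltW.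
by rewrite gtr0_norm.
Unshelve. all: by end_near.
Qed.

(** * Independence from the past and the maximal inequality on a finite grid *)

Definition past_rectangles (T : Type) (R : realType) (Y : nat -> T -> R)
    (k : nat) : set (set T) :=
  [set A | exists2 B : nat -> set R, (forall i, measurable (B i)) &
    A = \bigcap_(i < k) (Y i @^-1` B i)].

Section past.
Context d (T : measurableType d) (R : realType) (P : probability T R).
Context (Y : nat -> T -> R) (mY : forall i, measurable_fun setT (Y i)).

Let measurable_preim i (B : set R) : measurable B -> measurable (Y i @^-1` B).
Proof. by move=> mB; rewrite -[X in measurable X]setTI; exact: mY. Qed.

Lemma past_rectangles_setI_closed k : setI_closed (past_rectangles Y k).
Proof.
move=> _ _ [B mB ->] [C mC ->].
exists (fun i => B i `&` C i) => [i|]; first exact: measurableI.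
by rewrite -bigcapI.
Qed.

Lemma measurable_past_rectangles k : past_rectangles Y k `<=` measurable.
Proof.
move=> _ [B mB ->]; rewrite bigcap_mkord.
apply: bigsetI_measurable => i _; exact: measurable_preim.
Qed.

Lemma past_setT k : past_rectangles Y k setT.
Proof.
by exists (fun=> setT) => //; apply/seteqP; split.
Qed.

Lemma measurable_fun_past k i : (i < k)%N ->
  @measurable_fun _ _ (g_sigma_algebraType (past_rectangles Y k)) R setT (Y i).
Proof.
move=> ik _ B mB; rewrite setTI; apply: sub_sigma_algebra.
exists (fun j => if j == i then B else setT) => [j|]; first by case: ifP.
apply/seteqP; split=> [w Bw j jk /=|w /(_ i ik)/=].
  by case: eqP => // ->.
by rewrite eqxx.
Qed.

(** As functions of [A], both sides are finite measures; they agree on the rectangles, a pi-system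
    containing the whole space, hence on the sigma-algebra generated by [Y 0, ..., Y (k - 1)]. *)
Lemma past_independent k : mutually_independent P (fun i : 'I_k.+1 => Y i) ->
  forall B, measurable B -> forall A, <<s past_rectangles Y k>> A ->
  P (A `&` (Y k @^-1` B)) = (P A * P (Y k @^-1` B))%E.
Proof.
move=> indY B mB A sA.
have mD := measurable_preim k mB.
have PDfin := fin_num_measure P _ mD.
have PD0 : 0 <= fine (P (Y k @^-1` B)) by rewrite fine_ge0.
have numE : ((NngNum PD0)%:num)%:E = P (Y k @^-1` B) by rewrite /= fineK.
pose m1 := mrestr P mD.
pose m2 := mscale (NngNum PD0) P.
suff : m1 A = m2 A.
  by rewrite /m1 /m2 /mrestr /mscale numE => ->; rewrite muleC.
apply: (@g_sigma_algebra_measure_unique _ _ _ (past_rectangles Y k)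
    (@measurable_past_rectangles k) (fun=> setT) _ _ m1 m2) => //.
- by move=> _; exact: past_setT.
- by rewrite bigcup_const.
- exact: past_rectangles_setI_closed.
- move=> _ [C mC ->]; rewrite /m1 /m2 /mrestr /mscale numE.
  (* Used twice: with [E = B] for the rectangle cut by the event on [Y k], and with [E = setT] to
     express the probability of the rectangle alone as a product. *)
  have prodE E : measurable E ->
      P (\bigcap_(i < k) (Y i @^-1` C i) `&` (Y k @^-1` E)) =
      (\prod_(i < k) P (Y i @^-1` C i) * P (Y k @^-1` E))%E.
    move=> mE; pose CE i := if i == k then E else C i.
    have mCE i : measurable (CE i) by rewrite /CE; case: ifP.
    have := indY (fun i : 'I_k.+1 => CE i) (fun i => mCE i).
    rewrite big_ord_recr/= {3}/CE eqxx.
    under eq_bigr => i _ do rewrite /CE (ltn_eqF (ltn_ord i)).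
    move=> <-; congr (P _).
    apply/seteqP; split=> [w [wC wE] i _|w wC].
      by rewrite /CE /=; case: eqP => [->//|/eqP ik]; apply: wC => /=;
        rewrite ltn_neqAle ik -ltnS ltn_ord.
    split=> [i ik|]; last by have := wC ord_max I; rewrite /CE /= eqxx.
    have := wC (widen_ord (leqnSn k) (Ordinal ik)) I.
    by rewrite /CE /= ltn_eqF.
  apply: (etrans (prodE B mB)); rewrite muleC; congr (_ * _)%E.
    by rewrite fineK.
  have := prodE setT measurableT.
  rewrite preimage_setT setIT/= probability_setT mule1 => pE.
  exact: esym pE.
- move=> _; change (P ([set: T] `&` Y k @^-1` B) < +oo)%E.
  by rewrite setTI ltey_eq PDfin.
Qed.

End past.

(* With [A k] the event that [k] is the first index where [|X (s k)|] exceeds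
   [2 * c], either [|X (s N)| > c] or [|X (s N) - X (s k)| > c] on [A k]. The
   latter is independent of [A k], so that summing over [k] gives
   [q + q * \sum_k P (A k) <= 2 * q]. *)
Lemma levy_maximal d (T : measurableType d) (R : realType)
    (P : probability T R) (X : R -> {RV P >-> R}) (s : nat -> R) (N : nat)
    (c q : R) :
  0 <= c -> levy_process X -> s 0%N = 0 -> (forall i, s i < s i.+1) -> 0 <= q ->
  (forall tau, 0 <= tau <= s N -> (P [set w | (c < `|X tau w|)%R] <= q%:E)%E) ->
  (P (\big[setU/set0]_(k < N.+1) [set w | (2 * c < `|X (s k) w|)%R]) <=
   (2 * q)%:E)%E.
Proof.
move=> c0 [X0 indX homX _] s0 slt q0 tailX.
have sle : {homo s : i j / (i <= j)%N >-> i <= j}.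
  by apply: (homo_leq (@lexx _ _) (@le_trans _ _)) => i; exact: ltW.
have s_ge0 i : 0 <= s i by rewrite -s0 sle.
pose E k := [set w | 2 * c < `|X (s k) w|].
have mX t : measurable_fun setT (X t) by [].
have mE k : measurable (E k) by apply: measurable_norm_gt.
pose D k := [set w | c < `|X (s N) w - X (s k) w|].
have mD k : measurable (D k).
  by apply: measurable_norm_gt; exact: measurable_funB.
have mA k : measurable (seqDU E k) by exact: seqDU_measurable.
have mF : measurable [set w | c < `|X (s N) w|] by exact: measurable_norm_gt.
have AD k : (k < N.+1)%N -> (P (seqDU E k `&` D k) <= q%:E * P (seqDU E k))%E.
  (* The case [k = N] is separate because the increment from [s N] to itself is degenerate; there
     [D N] is empty as [0 <= c]. *)
  move=> kN; have [->|kltN] : k = N \/ (k < N)%N.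
  - by move: kN; rewrite ltnS leq_eqVlt => /orP[/eqP|]; [left|right].
  - rewrite (_ : _ `&` _ = set0) ?measure0 ?mule_ge0//.
    apply/seteqP; split => // w [_].
    by rewrite /D /= subrr normr0 ltNge c0.
  (* The instants [s 0 < ... < s k < s N < ...], so that [X (s N) - X (s k)]
     is a single increment. *)
  pose s' i := if (i <= k)%N then s i else s N + (i - k.+1)%:R.
  pose Y i : T -> R := increment X (s' i) (s' i.+1).
  have mY i : measurable_fun setT (Y i) by exact: measurable_funB.
  have indY : mutually_independent P (fun i : 'I_k.+1 => Y i).
    apply: indX => [|i]; first by rewrite /s' s0.
    rewrite ltnS => ik; rewrite /s' ik; case: ltnP => // ki.
    have -> : i = k by apply/eqP; rewrite eqn_leq ik.
    by rewrite subnn addr0 (lt_le_trans (slt k))// sle.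
  have YD : D k = Y k @^-1` [set x | c < `|x|].
    by rewrite /Y /increment /s' leqnn ltnn subnn addr0.
  have mB : measurable [set x : R | c < `|x|].
    exact: (@measurable_norm_gt _ R R id).
  rewrite YD (past_independent mY indY mB).
    rewrite muleC lee_wpmul2r//.
    (* By homogeneity the increment over [[s k, s N]] has the law of [X (s N - s k)], a time in
       [[0, s N]], where the tail bound applies. *)
    have := homX (s k) 0 (s N - s k) (s_ge0 _) (lexx _) _ _ mB.
    rewrite subr_ge0 sle ?(ltnW kltN)// => /(_ isT).
    rewrite subrKC add0r => sE.
    rewrite /Y /s' leqnn ltnn subnn addr0 sE.
    rewrite (_ : _ @^-1` _ = [set w | c < `|X (s N - s k) w|]).
      apply: tailX; rewrite subr_ge0 sle ?(ltnW kltN)//=.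
      by rewrite gerBl.
    by apply/seteqP; split => w /=; rewrite /increment X0 subr0.
  (* Up to index [k] the path is a partial sum of the increments [Y i] with [i < k], so the
     first-passage event [seqDU E k] belongs to the past sigma-algebra. *)
  have XY j : (j <= k)%N -> X (s j) = (fun w => \sum_(i < j) Y i w) :> (T -> R).
    move=> jk; apply/funext => w.
    rewrite (eq_bigr (fun i : 'I_j => X (s i.+1) w - X (s i) w)); last first.
      move=> i _; have ik : (i < k)%N by exact: leq_trans (ltn_ord i) jk.
      by rewrite /Y /increment /s' (ltnW ik) ik.
    by rewrite -(big_mkord xpredT (fun i => X (s i.+1) w - X (s i) w))
      telescope_sumr// s0 X0 subr0.
  pose Tk := g_sigma_algebraType (past_rectangles Y k).
  have mEk j : (j <= k)%N -> measurable (E j : set Tk).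
    move=> jk; apply: (@measurable_norm_gt _ Tk R (X (s j))).
    rewrite XY//; apply: measurable_sum => i.
    by apply: measurable_fun_past; exact: (leq_trans (ltn_ord i)).
  apply: (@measurableD _ Tk); first exact: mEk.
  apply: (@bigsetU_measurable _ Tk) => i _.
  by apply: mEk; exact: ltnW.
pose M := \big[setU/set0]_(k < N.+1) E k.
have mM : measurable M by exact: bigsetU_measurable.
have PM : P M = (\sum_(k < N.+1) P (seqDU E k))%E.
  by rewrite /M bigsetU_seqDU measure_bigsetU//; exact: trivIset_seqDU.
have sub : M `<=` [set w | c < `|X (s N) w|] `|`
    \big[setU/set0]_(k < N.+1) (seqDU E k `&` D k).
  move=> w Mw.
  have [k kN Akw] : (\bigcup_(k < N.+1) seqDU E k) w.
    by rewrite bigcup_mkord -bigsetU_seqDU.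
  have [h|h] := ltP c `|X (s N) w|; [by left|right].
  rewrite -(bigcup_mkord N.+1 (fun k => seqDU E k `&` D k)).
  exists k => //; split => //; rewrite /D /=.
  have : 2 * c < `|X (s k) w| by exact: (subset_seqDU Akw).
  have := ler_normB (X (s N) w) (X (s N) w - X (s k) w).
  rewrite opprB addrC subrK; lra.
have -> : (2 * q)%:E = (q%:E + q%:E)%E by rewrite -EFinD; congr EFin; lra.
rewrite -/M.
apply: (le_trans (le_measure P _ _ sub)); rewrite ?inE//.
  apply: measurableU => //.
  by apply: bigsetU_measurable => k _; exact: measurableI.
apply: (le_trans (measureU2 _ _ _)) => //.
  by apply: bigsetU_measurable => k _; exact: measurableI.
apply: leeD; first by apply: tailX; rewrite s_ge0 lexx.
have mAD k : measurable (seqDU E k `&` D k) by exact: measurableI.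
apply: (le_trans (Boole_inequality P (fun k _ => mAD k))).
apply: (@le_trans _ _ (\sum_(k < N.+1) q%:E * P (seqDU E k))%E).
  by apply: lee_sum => k _; exact: AD.
rewrite -ge0_sume_distrr// -PM.
by rewrite -[leRHS]mule1 lee_wpmul2l// probability_le1.
Qed.

(** * From dyadic grids to the supremum over [[0, t]] *)

Definition dyadic (R : realType) (t : R) (n k : nat) : R := t / 2 ^+ n * k%:R.

(** By right continuity, an excess over [c] at a time [tau < t] persists on a short interval to its
    right, which contains a dyadic point; the time [t] is itself dyadic. The event becomes a
    countable union. *)
Lemma sup_abs_gtE d (T : measurableType d) (R : realType)
    (P : probability T R) (X : R -> {RV P >-> R}) (t c : R) : 0 < t ->
  (forall w, cadlag (fun s => X s w)) ->
  [set w | (c%:E < sup_abs X t w)%E] =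
  \bigcup_n \big[setU/set0]_(k < (2 ^ n).+1) [set w | c < `|X (dyadic t n k) w|].
Proof.
move=> t0 cX; have p2 n : 0 < 2 ^+ n :> R by exact: exprn_gt0.
apply/seteqP; split=> w /=; last first.
  move=> [n _]; rewrite
    -(bigcup_mkord _ (fun k => [set w | c < `|X (dyadic t n k) w|])).
  move=> [k /= kn ck]; apply: (@lt_le_trans _ _ `|X (dyadic t n k) w|%:E).
    by rewrite lte_fin.
  apply: ereal_sup_ubound; exists (dyadic t n k) => //=.
  apply/andP; split; first by rewrite mulr_ge0// divr_ge0// ltW.
  by rewrite /dyadic mulrAC ler_pdivrMr// ler_pM2l// -natrX ler_nat.
move=> /ereal_sup_gt[_ [tau /= /andP[tau0 taut] <-]]; rewrite lte_fin => ctau.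
suff [n [k [kn ck]]] : exists n k, (k <= 2 ^ n)%N /\ c < `|X (dyadic t n k) w|.
  exists n => //; rewrite
    -(bigcup_mkord _ (fun k => [set w | c < `|X (dyadic t n k) w|])).
  by exists k.
have [tt|] := eqVneq tau t.
  by exists 0%N, 1%N; rewrite /dyadic expr0 divr1 mulr1 -tt.
move=> tauNt; have {tauNt}taut : tau < t by rewrite lt_neqAle tauNt.
have [rc _] := cX w.
have : \forall s \near tau^'+, c < `|X s w|.
  exact: (cvgr_gt _ (cvg_norm (rc _ tau0)) _ ctau).
move=> [e /= e0 He].
(* The mesh [t / 2 ^+ n] is smaller than [e]. The successor of the truncation selects the first grid
   point strictly after [tau], which a right neighbourhood excluding [tau] requires; it does not
   pass [t] because [tau < t]. *)
have [n hn] := lt_pow2 (t / e).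
exists n, (Num.truncn (tau * 2 ^+ n / t)).+1.
have x0 : 0 <= tau * 2 ^+ n / t.
  by rewrite divr_ge0 ?mulr_ge0 ?(ltW (p2 n)) ?(ltW t0).
have /andP[] := truncn_itv x0.
set k := Num.truncn _ => k1 k2.
have k1' : k%:R * (t / 2 ^+ n) <= tau by
  move: k1; rewrite ler_pdivlMr// mulrA ler_pdivrMr.
have k2' : tau < k.+1%:R * (t / 2 ^+ n) by
  move: k2; rewrite ltr_pdivrMr// mulrA ltr_pdivlMr.
split.
  rewrite -(ltr_nat R) natrX -(ltr_pM2r t0).
  apply: (@le_lt_trans _ _ (tau * 2 ^+ n)).
    by move: k1; rewrite ler_pdivlMr.
  by rewrite mulrC ltr_pM2l.
rewrite /dyadic mulrC; apply: He => //=.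
rewrite ltr0_norm ?subr_lt0// opprB ltrBlDr.
rewrite -natr1 mulrDl mul1r addrC ltr_leD//.
by rewrite ltr_pdivrMr// mulrC -ltr_pdivrMr.
Qed.

Lemma measurable_sup_abs d (T : measurableType d) (R : realType)
    (P : probability T R) (X : R -> {RV P >-> R}) (t : R) : 0 < t ->
  (forall w, cadlag (fun s => X s w)) -> measurable_fun setT (sup_abs X t).
Proof.
move=> t0 cX; apply: (measurability _ (ErealGenOInfty.measurableE R)).
move=> _ [_ [c ->] <-]; rewrite setTI.
rewrite (_ : _ @^-1` _ = [set w | (c%:E < sup_abs X t w)%E]); last first.
  by apply/seteqP; split => w /=; rewrite in_itv/= andbT.
rewrite sup_abs_gtE//; apply: bigcup_measurable => n _.
by apply: bigsetU_measurable => k _; exact: measurable_norm_gt.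
Qed.

(** The maximal inequality on each grid has a bound independent of the mesh. The grids are nested,
    so the grid events increase and continuity from below carries the bound to their union. *)
Lemma levy_sup_le d (T : measurableType d) (R : realType)
    (P : probability T R) (X : R -> {RV P >-> R}) (t c q : R) :
  0 < t -> 0 <= c -> 0 <= q -> levy_process X ->
  (forall tau, 0 <= tau <= t -> (P [set w | (c < `|X tau w|)%R] <= q%:E)%E) ->
  (P [set w | ((2 * c)%:E < sup_abs X t w)%E] <= (2 * q)%:E)%E.
Proof.
move=> t0 c0 q0 LX tailX; have [_ _ _ cX] := LX.
have p2 n : 0 < 2 ^+ n :> R by exact: exprn_gt0.
rewrite sup_abs_gtE//.
set F := fun n => \big[setU/set0]_(k < (2 ^ n).+1) _.
have mF n : measurable (F n).
  by apply: bigsetU_measurable => k _; exact: measurable_norm_gt.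
have ndF : {homo F : n m / (n <= m)%N >-> (n <= m)%O}.
  move=> n m nm; apply/subsetPset => w; rewrite /F.
  rewrite -(bigcup_mkord _ (fun k => [set w | 2 * c < `|X (dyadic t n k) w|])).
  rewrite -(bigcup_mkord _ (fun k => [set w | 2 * c < `|X (dyadic t m k) w|])).
  (* Index of the [k]-th point of the coarse grid within the finer one. *)
  move=> [k /= kn ck]; exists (k * 2 ^ (m - n))%N => /=.
    by rewrite ltnS -(subnK nm) expnD mulnC leq_mul// addnK.
  rewrite (_ : dyadic t m _ = dyadic t n k)// /dyadic natrM natrX.
  rewrite -{1}(subnK nm) exprD invfM.
  by field; rewrite !expf_neq0.
have cvF := nondecreasing_cvg_mu (mu := P) mF
  (bigcup_measurable (fun n _ => mF n)) ndF.
rewrite -(cvg_lim _ cvF)//; apply: lime_le.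
  by apply/cvg_ex; eexists; exact: cvF.
apply: nearW => n /=.
apply: (levy_maximal (s := dyadic t n) c0 LX) => //.
- by rewrite /dyadic mulr0.
- by move=> i; rewrite /dyadic ltr_pM2l ?divr_gt0// ltr_nat.
- by move=> tau; rewrite /dyadic natrX divfK ?gt_eqF//; exact: tailX.
Qed.

(** * Application to the stable process *)

Lemma powRV (R : realType) (x r : R) : 0 <= x -> x^-1 `^ r = (x `^ r)^-1.
Proof. by move=> x0; rewrite -!powR_inv1 ?powR_ge0// powRAC. Qed.

(** The exponent of the characteristic function has real part [- x] with [x = tau * |xi| ^ alpha],
    and an imaginary part bounded by a multiple of [x]. At [alpha = 1] this relies on [beta = 0]:
    the term [|xi| log |xi|] is not [O(|xi|)]. *)
Lemma stable_charfun_le d (T : measurableType d) (R : realType)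
    (P : probability T R) (X : R -> {RV P >-> R}) (alpha beta tau xi : R) :
  (alpha = 1 -> beta = 0) -> stable_process X alpha beta -> 0 <= tau ->
  1 - fine 'E_P[fun w => cos (xi * X tau w)] <=
  tau * (1 + `|beta * tan (pi * alpha / 2)|) * `|xi| `^ alpha.
Proof.
move=> a1 [_ HX] tau0.
set x := tau * `|xi| `^ alpha.
have x0 : 0 <= x by rewrite mulr_ge0// powR_ge0.
have [y ye yx] : exists2 y,
    - (tau%:C * stable_exponent alpha beta xi)%C = (- x +i* y)%C
    & `|y| <= x * `|beta * tan (pi * alpha / 2)|.
  rewrite /stable_exponent; case: eqP => [/[dup] /a1 b0 ae|_].
    exists 0; last by rewrite normr0 mulr_ge0.
    rewrite /x ae powRr1// b0 mulr0 mul0r.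
    by simpc.
  exists (x * (beta * Num.sg xi * tan (pi * alpha / 2))).
    simpc.
    by apply/eqP; rewrite eq_complex /= /x; apply/andP; split; apply/eqP; ring.
  rewrite normrM (ger0_norm x0) ler_wpM2l// mulrAC normrM -[leRHS]mulr1.
  by rewrite ler_wpM2l// normr_sg; case: (_ != 0).
have := HX tau xi tau0; rewrite ye /char_fun /= => -[-> _].
apply: (le_trans (one_sub_expcos_le y x0)).
rewrite mulrAC -/x mulrDr mulr1 lerD2l//.
Qed.

Lemma stable_sup_le d (T : measurableType d) (R : realType)
    (P : probability T R) (X : R -> {RV P >-> R}) (alpha beta : R) :
  0 < alpha -> (alpha = 1 -> beta = 0) -> stable_process X alpha beta ->
  exists K : R, forall t c, 0 < t -> 0 < c ->
    (P [set w | (c%:E < sup_abs X t w)%E] <= (K * (t / c `^ alpha))%:E)%E.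
Proof.
move=> alpha0 a1 HX; have [LX _] := HX.
pose M : R :=
  (1 + `|beta * tan (pi * alpha / 2)|) / (1 - cos 1) / (1 - 2^-1 `^ alpha).
have q1 := half_powR_lt1 alpha0.
have M0 : 0 <= M.
  apply: divr_ge0; last by rewrite subr_ge0 ltW.
  by apply: divr_ge0; [exact: addr_ge0|exact: ltW (sub1_cos1_gt0 R)].
(* The tail is estimated at level [c / 2], which costs [2 ^ alpha]; the maximal inequality then
   doubles both the level and the bound. *)
exists (2 * M * 2 `^ alpha) => t c t0 c0.
have c20 : 0 < c / 2 by rewrite divr_gt0.
rewrite (_ : c = 2 * (c / 2)); last by rewrite mulrC divfK.
rewrite {2}(_ : 2 * (c / 2) = c); last by rewrite mulrC divfK.
rewrite (_ : _ * (t / _) = 2 * (M * t * (c / 2)^-1 `^ alpha)); last first.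
  by rewrite invf_div powRM ?invr_ge0 ?(ltW c0)// powRV ?(ltW c0)//; ring.
apply: levy_sup_le => //; first exact: ltW.
  by rewrite mulr_ge0 ?powR_ge0// mulr_ge0// ltW.
move=> tau /andP[tau0 taut].
pose D := tau * (1 + `|beta * tan (pi * alpha / 2)|).
have D0 : 0 <= D by rewrite mulr_ge0// addr_ge0.
have HD xi := stable_charfun_le xi a1 HX tau0.
apply: (le_trans (tail_le alpha0 D0 c20 HD)).
rewrite lee_fin ler_wpM2r ?powR_ge0//.
(* The bound at time [tau] is linear in [tau], so [tau <= t] makes it uniform on [[0, t]]. *)
rewrite (_ : _ / _ / _ = M * tau); last by rewrite /M /D; ring.
by rewrite ler_wpM2l.
Qed.

(** * The two limits, by squeezing *)

Theorem corollary3p3 (d : measure_display) (T : measurableType d)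
    (R : realType) (P : probability T R) (X : R -> {RV P >-> R})
    (alpha beta : R) (a : R -> R)
    (Hparam : [\/ [/\ 0 < alpha, alpha < 2, alpha != 1, -1 < beta & beta < 1],
                  [/\ 1 < alpha, alpha < 2 & beta = 1 \/ beta = -1] |
                  alpha = 1 /\ beta = 0])
    (HX : stable_process X alpha beta)
    (Ha_pos : forall t : R, 0 < t -> 0 < a t)
    (Ha : t / (a t `^ alpha) @[t --> +oo] --> 0) :
  (p_alpha X t (a t) @[t --> +oo] --> 1%E) /\
  (P [set w | ((a t)%:E < sup_abs X t w)%E] @[t --> +oo] --> 0%E).
Proof.
have alpha0 : 0 < alpha by case: Hparam => [[]//|[a1 _ _]|[-> _]//]; lra.
(* Only the third parameter regime allows [alpha = 1]. *)
have a1 : alpha = 1 -> beta = 0.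
  case: Hparam => [[_ _ /eqP//]|[a1 _ _] ae|[]//]; lra.
have cX : forall w, cadlag (fun s => X s w) by have [[]] := HX.
have [K HK] := stable_sup_le alpha0 a1 HX.
have mle t c : 0 < t -> measurable [set w | (c%:E < sup_abs X t w)%E].
  by move=> t0; rewrite -[X in measurable X]setTI;
     apply: emeasurable_fun_o_infty => //; exact: measurable_sup_abs.
split.
  (* The complement of [sup < a t] is [sup >= a t], whereas the tail bound concerns a strict excess.
     Passing to the level [a t / 2] suffices, since [sup <= a t / 2] implies [sup < a t]; this is
     the source of the factor [2 ^ alpha]. *)
  apply: (@squeeze_cvge _ _ _ _
    (fun t => (1 - K * 2 `^ alpha * (t / a t `^ alpha))%:E) _ (cst 1%E)).
  - near=> t.
    have t0 : 0 < t by near: t; exact: nbhs_pinfty_gt.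
    have at0 := Ha_pos _ t0.
    have mp : measurable [set w | (sup_abs X t w < (a t)%:E)%E].
      by rewrite -[X in measurable X]setTI; apply: emeasurable_fun_infty_o => //;
        exact: measurable_sup_abs.
    rewrite /p_alpha probability_le1// andbT.
    have a20 : 0 < a t / 2 by rewrite divr_gt0.
    apply: (@le_trans _ _ (P (~` [set w | ((a t / 2)%:E < sup_abs X t w)%E]))).
      rewrite probability_setC; last exact: mle.
      rewrite EFinB leeB//; apply: (le_trans (HK _ _ t0 a20)).
      rewrite lee_fin le_eqVlt; apply/orP; left; apply/eqP.
      by rewrite powRM ?invr_ge0 ?(ltW at0)// powRV// invfM invrK; ring.
    apply: le_measure; rewrite ?inE//; first by apply: measurableC; exact: mle.
    move=> w /= /negP; rewrite -leNgt => /le_lt_trans; apply.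
    by rewrite lte_fin; lra.
  - apply: cvg_EFin; first exact: nearW.
    rewrite -[X in _ --> X]subr0 -(mulr0 (K * 2 `^ alpha)).
    by apply: cvgB; [exact: cvg_cst|exact: cvgM (cvg_cst _) Ha].
  - exact: cvg_cst.
(* Here the event is already strict, so the tail bound applies at level [a t] directly. *)
apply: (@squeeze_cvge _ _ _ _ (cst 0%E) _ (fun t => (K * (t / a t `^ alpha))%:E)).
- near=> t.
  have t0 : 0 < t by near: t; exact: nbhs_pinfty_gt.
  by rewrite measure_ge0 HK// Ha_pos.
- exact: cvg_cst.
- apply: cvg_EFin; first exact: nearW.
  by rewrite -(mulr0 K); exact: cvgM (cvg_cst _) Ha.
Unshelve. all: by end_near.
Qed.
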